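(* Let $L$ be a one-sorted first-order language (with equality, possibly with relation symbols and function symbols). Let $I$ be an index set and let $\mathcal{L}$ be any extension of the language of Boolean algebras $\{0,1,\wedge,\vee,\bar{}\ \}$ which contains a unary relation symbol $Fin$, and let $\mathbb{B}_{\mathcal{L}}$ be an $\mathcal{L}$-structure on the powerset $Powerset(I)$ in which $0,1,\wedge,\vee,\bar{}\ $ have their usual interpretations and $Fin$ is interpreted as the set of finite subsets of $I$. Let $\{M_i: i\in I\}$ be a family of $L$-structures and let $\Phi(x)$ be an $L$-formula in a single free variable such that for every $i$ the set $\Phi(M_i)=\{a\in M_i: M_i\models\Phi(a)\}$ is an $L$-substructure of $M_i$. Let $\Pi=\prod_{i\in I}M_i$ be the product $L$-structure (function symbols interpreted coordinatewise, and a basic relation $R$ holds of a tuple $\bar f$ iff $R(\bar f(i))$ holds in $M_i$ for all $i$). For an $L$-formula $\Theta(\bar w)$ and a tuple $\bar f$ from $\Pi$ put $[[\Theta(\bar f)]]=\{i\in I: M_i\models \Theta(\bar f(i))\}$. Let $L(\mathbb{B}_{\mathcal{L}})$ be the expansion of $L$ by a new relation symbol for each $\Psi\circ\langle\Phi_1,\dots,\Phi_m\rangle$, where $\Psi(z_1,\dots,z_m)$ is an $\mathcal{L}$-formula and $\Phi_1,\dots,\Phi_m$ are $L$-formulas in a common tuple of variables, interpreted in $\Pi$ by: $\Pi\models\Psi\circ\langle\Phi_1,\dots,\Phi_m\rangle(\bar f)$ iff $\mathbb{B}_{\mathcal{L}}\models\Psi([[\Phi_1(\bar f)]],\dots,[[\Phi_m(\bar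 f)]])$. Let $\Pi^{(\Phi)}$ (the restricted product of the $M_i$ relative to $\Phi$) be the substructure of $\Pi$ consisting of those $f\in\Pi$ such that $[[\neg\Phi(f)]]$ is finite, with the induced $L(\mathbb{B}_{\mathcal{L}})$-structure. Then $\Pi^{(\Phi)}$ has quantifier-elimination as an $L(\mathbb{B}_{\mathcal{L}})$-structure, uniformly in $\{M_i:i\in I\}$ and $\Phi(x)$, and effectively.
   Context: Feferman–Vaught type quantifier elimination for restricted products in the one-sorted case. The proof relativizes quantifiers to the definable substructure $\Pi^{(\Phi)}$ (replacing $\exists y$ by $\exists y\,(Fin([[\neg\Phi(y)]])\wedge\dots)$) and applies the Feferman–Vaught quantifier elimination for the full product $\Pi$ in $L(\mathbb{B}_{\mathcal{L}})$, which holds uniformly for all families $\{M_i\}$. *)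

(* Defs.v *)
From mathcomp Require Import all_boot.
From mathcomp Require Import boolp classical_sets functions cardinality.

Set Implicit Arguments.
Unset Strict Implicit.
Unset Printing Implicit Defensive.

Local Open Scope classical_set_scope.

Record language := Language {
  fsym : Type;
  farity : fsym -> nat;
  rsym : Type;
  rarity : rsym -> nat }.
Arguments farity {l} _.
Arguments rarity {l} _.

(** Terms and formulas are indexed by the number [n] of free variables
    available, so [formula L n] is the set of [L]-formulas in a common
    [n]-tuple of variables. *)
Inductive term (L : language) (n : nat) : Type :=
| tvar of 'I_n
| tapp (F : fsym L) of ('I_(farity F) -> term L n).
Arguments tvar {L n} _.
Arguments tapp {L n} F _.

(** [fex] binds variable [0] of its body; variable [i.+1] of the body is
    variable [i] outside.  The other connectives are the usual abbreviations. *)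
Inductive formula (L : language) : nat -> Type :=
| feq n of term L n & term L n : formula L n
| frel n (R : rsym L) of ('I_(rarity R) -> term L n) : formula L n
| fnot n of formula L n : formula L n
| fand n of formula L n & formula L n : formula L n
| fex n of formula L n.+1 : formula L n.
Arguments feq {L n} _ _.
Arguments frel {L n} R _.
Arguments fnot {L n} _.
Arguments fand {L n} _ _.
Arguments fex {L n} _.

Fixpoint quantifier_free (L : language) n (phi : formula L n) : bool :=
  match phi with
  | feq _ _ _ | frel _ _ _ => true
  | fnot _ a => quantifier_free a
  | fand _ a b => quantifier_free a && quantifier_free b
  | fex _ _ => false
  end.

(** An [L]-structure with universe [M].  The universe may be empty. *)
Record interp (L : language) (M : Type) := Interp {
  fun_of : forall F : fsym L, ('I_(farity F) -> M) -> M;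
  rel_of : forall R : rsym L, ('I_(rarity R) -> M) -> Prop }.
Arguments fun_of {L M} _ F _.
Arguments rel_of {L M} _ R _.

Fixpoint teval (L : language) (M : Type) (A : interp L M) n (v : 'I_n -> M)
    (t : term L n) : M :=
  match t with
  | tvar i => v i
  | tapp F a => fun_of A F (fun k => teval A v (a k))
  end.

Definition vcons (M : Type) n (x : M) (v : 'I_n -> M) : 'I_n.+1 -> M :=
  fun i => if unlift ord0 i is Some j then v j else x.

Fixpoint sat (L : language) (M : Type) (A : interp L M) n
    (phi : formula L n) : ('I_n -> M) -> Prop :=
  match phi with
  | feq _ t u => fun v => teval A v t = teval A v u
  | frel _ R a => fun v => rel_of A R (fun k => teval A v (a k))
  | fnot _ a => fun v => ~ sat A a v
  | fand _ a b => fun v => sat A a v /\ sat A b v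
  | fex _ a => fun v => exists x : M, sat A a (vcons x v)
  end.

Definition substructure (L : language) (M : Type) (A : interp L M)
    (S : set M) : Prop :=
  forall (F : fsym L) (a : 'I_(farity F) -> M),
    (forall k, S (a k)) -> S (fun_of A F a).

Definition sub_interp (L : language) (M : Type) (A : interp L M) (S : set M)
    (hS : substructure A S) : interp L {x : M | S x} :=
  Interp
    (fun F a => exist S (fun_of A F (fun k => sval (a k)))
                        (hS F (fun k => sval (a k)) (fun k => svalP (a k))))
    (fun R a => rel_of A R (fun k => sval (a k))).

Definition definable (L : language) (M : Type) (A : interp L M)
    (Phi : formula L 1) : set M :=
  [set a | sat A Phi (fun _ => a)].

Inductive ba_fsym := ba_zero | ba_one | ba_meet | ba_join | ba_compl.

Definition ba_arity (s : ba_fsym) : nat :=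
  match s with
  | ba_zero | ba_one => 0
  | ba_meet | ba_join => 2
  | ba_compl => 1
  end.

(** The extension by the symbols of an arbitrary language [X]; the relation
    symbol [inl tt] is [Fin]. *)
Definition ba_ext (X : language) : language :=
  {| fsym := ba_fsym + fsym X;
     farity := fun s => match s with inl b => ba_arity b | inr x => farity x end;
     rsym := unit + rsym X;
     rarity := fun s => match s with inl _ => 1 | inr x => rarity x end |}.

Record powerset_structure (X : language) (I : Type)
    (B : interp (ba_ext X) (set I)) : Prop := PowersetStructure {
  ps_zero : forall a, fun_of B (inl ba_zero) a = set0;
  ps_one : forall a, fun_of B (inl ba_one) a = setT;
  ps_meet : forall a : 'I_2 -> set I,
    fun_of B (inl ba_meet) a = a ord0 `&` a ord_max;
  ps_join : forall a : 'I_2 -> set I,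
    fun_of B (inl ba_join) a = a ord0 `|` a ord_max;
  ps_compl : forall a : 'I_1 -> set I,
    fun_of B (inl ba_compl) a = ~` a ord0;
  ps_fin : forall a : 'I_1 -> set I,
    rel_of B (inl tt) a <-> finite_set (a ord0) }.

(** The symbol [Psi o <Phi_1, ..., Phi_m>]. *)
Record fv_sym (L X : language) := FVSym {
  fv_arity : nat;
  fv_size : nat;
  fv_psi : formula (ba_ext X) fv_size;
  fv_phi : 'I_fv_size -> formula L fv_arity }.
Arguments fv_phi {L X} _ _.

Definition fv_lang (L X : language) : language :=
  {| fsym := fsym L;
     farity := @farity L;
     rsym := rsym L + fv_sym L X;
     rarity := fun s => match s with inl R => rarity R | inr s => fv_arity s end |}.

(** The set written [[Theta(f)]] in the Feferman-Vaught setting. *)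
Definition truth_set (L : language) (I : Type) (M : I -> Type)
    (A : forall i, interp L (M i)) n (Theta : formula L n)
    (f : 'I_n -> forall i, M i) : set I :=
  [set i | sat (A i) Theta (fun k => f k i)].

Definition product_interp (L X : language) (I : Type) (M : I -> Type)
    (A : forall i, interp L (M i)) (B : interp (ba_ext X) (set I)) :
    interp (fv_lang L X) (forall i, M i) :=
  @Interp (fv_lang L X) (forall i, M i)
    (fun F a i => fun_of (A i) F (fun k => a k i))
    (fun s =>
       match s return ('I_(@rarity (fv_lang L X) s) -> forall i, M i) -> Prop with
       | inl R => fun a => forall i, rel_of (A i) R (fun k => a k i)
       | inr s => fun a =>
           sat B (fv_psi s) (fun j => truth_set A (fv_phi s j) a)
       end).

Definition restricted (L : language) (I : Type) (M : I -> Type)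
    (A : forall i, interp L (M i)) (Phi : formula L 1) : set (forall i, M i) :=
  [set f | finite_set (truth_set A (fnot Phi) (fun _ => f))].

Lemma restricted_substructure (L X : language) (I : Type) (M : I -> Type)
    (A : forall i, interp L (M i)) (B : interp (ba_ext X) (set I))
    (Phi : formula L 1)
    (hPhi : forall i, substructure (A i) (definable (A i) Phi)) :
  substructure (product_interp A B) (restricted A Phi).
Proof.
move=> F a ha.
apply: (@sub_finite_set _ _
  (\bigcup_(k in [set: 'I_(farity F)]) truth_set A (fnot Phi) (fun _ => a k))).
  move=> i /= ni; apply: contrapT => nU; apply: ni.
  apply: (hPhi i F (fun k => a k i)) => k /=.
  by apply: contrapT => nk; apply: nU; exists k.
by apply: bigcup_finite => [|k _]; [exact: finite_finset | exact: ha].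
Qed.

Definition restricted_interp (L X : language) (I : Type) (M : I -> Type)
    (A : forall i, interp L (M i)) (B : interp (ba_ext X) (set I))
    (Phi : formula L 1)
    (hPhi : forall i, substructure (A i) (definable (A i) Phi)) :
    interp (fv_lang L X) {f : forall i, M i | restricted A Phi f} :=
  sub_interp (restricted_substructure B hPhi).

(** The model of computation is pure first-order LISP over binary trees with
    natural numbers at the leaves. *)

Inductive sexp := Atom of nat | Cons of sexp & sexp.

Inductive expr :=
| EArg
| EQuote of sexp
| ECons of expr & expr
| EHd of expr
| ETl of expr
| EIsAtom of expr
| EEqAtom of expr & expr
| ESucc of expr
| EPred of expr
| EIf of expr & expr & expr
| ECall of nat & expr.

(** A program is a list of mutually recursive unary functions, each given by
    its body; execution starts with the function number [0]. *)
Definition program := seq expr.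

Definition body (p : program) (k : nat) : expr := nth EArg p k.

(** [evals p x e y]: call-by-value evaluation of [e], with argument [x],
    terminates with value [y]. *)
Inductive evals (p : program) (x : sexp) : expr -> sexp -> Prop :=
| ev_arg : evals p x EArg x
| ev_quote c : evals p x (EQuote c) c
| ev_cons e1 e2 y1 y2 : evals p x e1 y1 -> evals p x e2 y2 ->
    evals p x (ECons e1 e2) (Cons y1 y2)
| ev_hd e y1 y2 : evals p x e (Cons y1 y2) -> evals p x (EHd e) y1
| ev_tl e y1 y2 : evals p x e (Cons y1 y2) -> evals p x (ETl e) y2
| ev_isatom e y : evals p x e y ->
    evals p x (EIsAtom e) (Atom (if y is Atom _ then 1 else 0))
| ev_eqatom e1 e2 k1 k2 : evals p x e1 (Atom k1) -> evals p x e2 (Atom k2) ->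
    evals p x (EEqAtom e1 e2) (Atom (k1 == k2))
| ev_succ e k : evals p x e (Atom k) -> evals p x (ESucc e) (Atom k.+1)
| ev_pred e k : evals p x e (Atom k) -> evals p x (EPred e) (Atom k.-1)
| ev_if_true e e1 e2 k y : evals p x e (Atom k.+1) -> evals p x e1 y ->
    evals p x (EIf e e1 e2) y
| ev_if_false e e1 e2 y : evals p x e (Atom 0) -> evals p x e2 y ->
    evals p x (EIf e e1 e2) y
| ev_call k e y z : evals p x e y -> evals p y (body p k) z ->
    evals p x (ECall k e) z.

Lemma evals_det p x e y z : evals p x e y -> evals p x e z -> y = z.
Proof.
move=> h; revert z; induction h; intros w hw; inversion hw; subst;
  repeat match goal with
  | ih : forall z, evals ?p ?x ?e z -> _ = z, h : evals ?p ?x ?e _ |- _ =>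
      apply ih in h; try discriminate h; try (injection h; intros); subst; clear ih
  end; by [].
Qed.

Definition computes (p : program) (x y : sexp) : Prop := evals p x (body p 0) y.

Definition slist (s : seq sexp) : sexp := foldr Cons (Atom 0) s.

(** A naming of the symbols of [L] by symbolic expressions.  Injectivity is not
    required: an uncountable language has no injective naming, but any finite
    set of its symbols is named injectively by some naming of the language. *)
Record coding (L : language) := Coding {
  code_fsym : fsym L -> sexp;
  code_rsym : rsym L -> sexp }.

Fixpoint code_term (L : language) (c : coding L) n (t : term L n) : sexp :=
  match t with
  | tvar i => Cons (Atom 0) (Atom i)
  | tapp F a =>
      Cons (Atom 1)
        (Cons (code_fsym c F)
           (slist (map (fun k => code_term c (a k)) (enum 'I_(farity F)))))
  end.

Fixpoint code_formula (L : language) (c : coding L) n (phi : formula L n) : sexp :=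
  match phi with
  | feq _ t u => Cons (Atom 0) (Cons (code_term c t) (code_term c u))
  | frel _ R a =>
      Cons (Atom 1)
        (Cons (code_rsym c R)
           (slist (map (fun k => code_term c (a k)) (enum 'I_(rarity R)))))
  | fnot _ a => Cons (Atom 2) (code_formula c a)
  | fand _ a b => Cons (Atom 3) (Cons (code_formula c a) (code_formula c b))
  | fex _ a => Cons (Atom 4) (code_formula c a)
  end.

Definition code_ba_fsym (s : ba_fsym) : sexp :=
  Atom match s with
       | ba_zero => 0 | ba_one => 1 | ba_meet => 2 | ba_join => 3 | ba_compl => 4
       end.

Definition ba_ext_coding (X : language) (c : coding X) : coding (ba_ext X) :=
  @Coding (ba_ext X)
    (fun s => match s with
              | inl b => Cons (Atom 0) (code_ba_fsym b)
              | inr x => Cons (Atom 1) (code_fsym c x)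
              end)
    (fun s => match s with
              | inl _ => Cons (Atom 0) (Atom 0)
              | inr x => Cons (Atom 1) (code_rsym c x)
              end).

Definition fv_coding (L X : language) (cL : coding L) (cX : coding X) :
    coding (fv_lang L X) :=
  @Coding (fv_lang L X)
    (code_fsym cL)
    (fun s => match s with
              | inl R => Cons (Atom 0) (code_rsym cL R)
              | inr s =>
                  Cons (Atom 1)
                    (slist [:: Atom (fv_arity s);
                               code_formula (ba_ext_coding cX) (fv_psi s);
                               slist [seq code_formula cL (fv_phi s j)
                                     | j <- enum 'I_(fv_size s)]])
              end).

(* Main.v *)
(** Every formula is equivalent on the restricted product to a single atom
    [psi o <phi_1, ..., phi_m>], by induction on the formula.  Equations and
    basic relations are [z = 1] applied to one truth set, and the connectives
    act on [psi].  For [exists y], put [phi_{m+1} := ~ Phi(y)]; the sets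
    [Z_j = [[phi_j(y, f)]]] that arise from some [y] in the product are exactly
    those for which, at every index, the sign condition on the [phi_j] described
    by the [Z_j] is satisfiable, that is, for which each of the [2^(m+1)] Boolean
    combinations [T(Z)] is contained in the truth set of [exists y, F(y, f)],
    with [F] the same combination of the [phi_j].  So the quantifier moves to
    [psi], as [exists Z_1 ... Z_{m+1}] under the conditions [Fin(Z_{m+1})] and
    [T(Z) <= u_T]. *)

Require Import Defs.
From Stdlib Require List.
From mathcomp Require Import all_boot boolp classical_sets functions cardinality.

Set Implicit Arguments.
Unset Strict Implicit.
Unset Printing Implicit Defensive.

Local Open Scope classical_set_scope.

(** [all_boot] gives other meanings to these two names. *)
Local Notation frel := Defs.frel.
Local Notation Cons := Defs.Cons.

(** * Environments and renaming *)

Definition vcat (M : Type) k n (w : 'I_k -> M) (v : 'I_n -> M) : 'I_(k + n) -> M :=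
  fun i => match fintype.split i with inl j => w j | inr j => v j end.

Lemma vcat_lshift (M : Type) k n (w : 'I_k -> M) (v : 'I_n -> M) j :
  vcat w v (lshift n j) = w j.
Proof. by rewrite /vcat -[lshift n j]/(unsplit (inl j)) unsplitK. Qed.

Lemma vcat_rshift (M : Type) k n (w : 'I_k -> M) (v : 'I_n -> M) j :
  vcat w v (rshift k j) = v j.
Proof. by rewrite /vcat -[rshift k j]/(unsplit (inr j)) unsplitK. Qed.

Lemma vcons0 (M : Type) n x (v : 'I_n -> M) : vcons x v ord0 = x.
Proof. by rewrite /vcons unlift_none. Qed.

Lemma vcons_lift (M : Type) n x (v : 'I_n -> M) j : vcons x v (lift ord0 j) = v j.
Proof. by rewrite /vcons liftK. Qed.

Lemma vcons_comp (M N : Type) (h : M -> N) n x (v : 'I_n -> M) :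
  (fun i => h (vcons x v i)) = vcons (h x) (fun i => h (v i)).
Proof. by apply/funext => i; rewrite /vcons; case: unlift. Qed.

(** [k.+1 + n] reduces to [(k + n).+1], so both sides are environments of one type; this is what
    lets [fexs] bind its variables one at a time. *)
Lemma vcons_vcat (M : Type) k n x (w : 'I_k -> M) (v : 'I_n -> M) :
  vcat (vcons x w) v = vcons x (vcat w v) :> ('I_(k + n).+1 -> M).
Proof.
apply/funext => i; have [j ->|j ->] := split_ordP (i : 'I_(k.+1 + n)).
  rewrite vcat_lshift; have [j' ->|->] := unliftP ord0 j.
    have -> : lshift n (lift ord0 j') = lift ord0 (lshift n j') by apply/val_inj.
    by rewrite !vcons_lift vcat_lshift.
  have -> : lshift n (ord0 : 'I_k.+1) = ord0 by apply/val_inj.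
  by rewrite !vcons0.
transitivity (v j); first exact: (vcat_rshift (k := k.+1)).
have -> : rshift k.+1 j = lift ord0 (rshift k j) by apply/val_inj.
by rewrite vcons_lift vcat_rshift.
Qed.

Lemma vcons_surj (M : Type) n (w : 'I_n.+1 -> M) :
  vcons (w ord0) (fun j => w (lift ord0 j)) = w.
Proof.
apply/funext => i; have [j ->|->] := unliftP ord0 i.
- by rewrite vcons_lift.
- by rewrite vcons0.
Qed.

Lemma map_nat_enum_ord n : map (@nat_of_ord n) (enum 'I_n) = iota 0 n.
Proof. exact: val_enum_ord. Qed.

Lemma size_map_enum_ord (T : Type) n (f : 'I_n -> T) :
  size [seq f j | j <- enum 'I_n] = n.
Proof. by rewrite size_map size_enum_ord. Qed.

Lemma enum_ordD k n :
  enum 'I_(k + n) = [seq lshift n j | j <- enum 'I_k] ++ [seq rshift k j | j <- enum 'I_n].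
Proof.
apply: (inj_map (@ord_inj (k + n))).
rewrite map_cat -(map_comp _ (@lshift k n)) -(map_comp _ (@rshift k n)).
rewrite map_nat_enum_ord iotaD -[X in iota X n]addn0 iotaDl.
rewrite -(map_nat_enum_ord k) -(map_nat_enum_ord n) -(map_comp _ (@nat_of_ord n)).
by congr (_ ++ _); exact: eq_map.
Qed.

(** * Renaming, quantifier blocks, finite conjunctions and substitution *)

Section Renaming.
Variable L : language.

Fixpoint tren n m (r : 'I_n -> 'I_m) (t : term L n) : term L m :=
  match t with
  | tvar i => tvar (r i)
  | tapp F a => tapp F (fun k => tren r (a k))
  end.

Fixpoint fren n (phi : formula L n) : forall m, ('I_n -> 'I_m) -> formula L m :=
  match phi with
  | feq _ t u => fun m r => feq (tren r t) (tren r u)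
  | frel _ R a => fun m r => frel R (fun k => tren r (a k))
  | fnot _ a => fun m r => fnot (fren a r)
  | fand _ a b => fun m r => fand (fren a r) (fren b r)
  | fex _ a => fun m r => fex (fren a (vcons ord0 (fun j => lift ord0 (r j))))
  end.

Lemma teval_tren (M : Type) (A : interp L M) n m (r : 'I_n -> 'I_m) v t :
  teval A v (tren r t) = teval A (fun i => v (r i)) t.
Proof.
by elim: t => //= F a IH; congr fun_of; apply/funext => k; exact: IH.
Qed.

Lemma sat_fren (M : Type) (A : interp L M) n (phi : formula L n) m
    (r : 'I_n -> 'I_m) v :
  sat A (fren phi r) v <-> sat A phi (fun i => v (r i)).
Proof.
elim: phi m r v => /= {n} [n t u|n R a|n a IH|n a IHa b IHb|n a IH] m r v.
- by rewrite !teval_tren.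
- by under eq_fun do rewrite teval_tren.
- by rewrite IH.
- by rewrite IHa IHb.
- have e x : (fun i => vcons x v (vcons ord0 (fun j => lift ord0 (r j)) i)) =
      vcons x (fun i => v (r i)).
    by rewrite vcons_comp vcons0; congr vcons; apply/funext => i; rewrite vcons_lift.
  by split=> -[x hx]; exists x; move: hx; rewrite IH e.
Qed.

(** Codes record the number of a variable but not the length of its context, so a renaming such as
    [lshift] costs the program nothing. *)
Lemma code_tren (c : coding L) n m (r : 'I_n -> 'I_m) t :
  (forall i, r i = i :> nat) -> code_term c (tren r t) = code_term c t.
Proof.
move=> hr; elim: t => /= [i|F a IH]; first by rewrite hr.
by under eq_map do rewrite IH.
Qed.

Lemma code_fren (c : coding L) n (phi : formula L n) m (r : 'I_n -> 'I_m) :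
  (forall i, r i = i :> nat) -> code_formula c (fren phi r) = code_formula c phi.
Proof.
elim: phi m r => /= {n} [n t u|n R a|n a IH|n a IHa b IHb|n a IH] m r hr.
- by rewrite !code_tren.
- by under eq_map do rewrite code_tren //.
- by rewrite IH.
- by rewrite IHa // IHb.
- rewrite IH // => i; have [j ->|->] := unliftP ord0 i.
  + by rewrite vcons_lift /= /bump !add1n hr.
  + by rewrite vcons0.
Qed.

Fixpoint fexs k n : formula L (k + n) -> formula L n :=
  match k with
  | 0 => fun phi => phi
  | k'.+1 => fun phi => fexs (k := k') (fex phi)
  end.

Lemma sat_fexs (M : Type) (A : interp L M) k n (phi : formula L (k + n)) v :
  sat A (fexs phi) v <-> exists w : 'I_k -> M, sat A phi (vcat w v).
Proof.
elim: k phi => [|k IH] phi /=.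
  have e (w : 'I_0 -> M) : vcat w v = v.
    apply/funext => i; have [[]//|j ->] := split_ordP (i : 'I_(0 + n)).
    by rewrite vcat_rshift; congr v; apply/val_inj.
  split=> [h|[w]]; last by rewrite e.
  have w0 : 'I_0 -> M by case.
  by exists w0; rewrite e.
rewrite IH /=; split=> [[w [x h]]|[w h]].
- by exists (vcons x w); rewrite vcons_vcat.
- exists (fun j => w (lift ord0 j)), (w ord0).
  by rewrite -vcons_vcat vcons_surj.
Qed.

Lemma code_fexs (c : coding L) k n (phi : formula L (k + n)) :
  code_formula c (fexs phi) = iter k (Cons (Atom 4)) (code_formula c phi).
Proof. by elim: k phi => //= k IH phi; rewrite IH -iterSr. Qed.

Lemma sat_fand (M : Type) (A : interp L M) n (a b : formula L n) v :
  sat A (fand a b) v <-> sat A a v /\ sat A b v.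
Proof. by []. Qed.

(** The base [b] ends the conjunction, because formulas have no constant for truth. *)
Definition fands (J : Type) n (g : J -> formula L n) (b : formula L n) (s : seq J) :=
  foldr (fun j => fand (g j)) b s.

Lemma sat_fands (M : Type) (A : interp L M) (J : eqType) n (g : J -> formula L n) b s v :
  sat A (fands g b s) v <-> (forall j, j \in s -> sat A (g j) v) /\ sat A b v.
Proof.
elim: s => [|j s IH] /=; first by split=> [|[]].
rewrite IH; split=> [[hj [hs hb]]|[hs hb]].
- by split=> // i; rewrite inE => /predU1P[->|/hs].
- by split; [|split=> // i hi]; apply: hs; rewrite inE ?eqxx ?hi ?orbT.
Qed.

Lemma code_fands (c : coding L) (J : Type) n (g : J -> formula L n) b s :
  code_formula c (fands g b s) =
  foldr (fun j => Cons (Atom 3) \o Cons (code_formula c (g j))) (code_formula c b) s.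
Proof. by elim: s => //= j s ->. Qed.

(** Instead of substituting [t] in [phi] below the quantifiers of [phi], we
    write [exists y, y = t /\ phi y]: the code of [phi] is then unchanged. *)
Definition fsubst k n (t : 'I_k -> term L n) (phi : formula L k) : formula L n :=
  fexs (fands (fun j => feq (tvar (lshift n j)) (tren (@rshift k n) (t j)))
              (fren phi (@lshift k n)) (enum 'I_k)).

Lemma sat_fsubst (M : Type) (A : interp L M) k n (t : 'I_k -> term L n) phi v :
  sat A (fsubst t phi) v <-> sat A phi (fun j => teval A v (t j)).
Proof.
rewrite sat_fexs.
have rv (w : 'I_k -> M) : (fun i => vcat w v (rshift k i)) = v.
  by apply/funext => i; rewrite vcat_rshift.
split=> [[w]|h].
- rewrite sat_fands sat_fren => -[hw].
  congr sat; apply/funext => j; rewrite vcat_lshift.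
  by have /= := hw j (mem_enum _ j); rewrite vcat_lshift teval_tren rv.
- exists (fun j => teval A v (t j)); rewrite sat_fands sat_fren; split=> [j _ /=|].
    by rewrite vcat_lshift teval_tren rv.
  by under eq_fun do rewrite vcat_lshift.
Qed.

End Renaming.

(** * Quantifier elimination *)

Section NormalForm.
Variables L X : language.
Implicit Type n : nat.

(** The content of an [fv_sym], with the arity made a parameter so that it follows the number of
    free variables of the formula being eliminated. *)
Record fv_form n := FVForm {
  form_size : nat;
  form_psi : formula (ba_ext X) form_size;
  form_phi : 'I_form_size -> formula L n }.

Definition bone n : term (ba_ext X) n :=
  @tapp (ba_ext X) n (inl ba_one) (fun k : 'I_0 => False_rect _ (notF (ltn_ord k))).
Definition bmeet n (a b : term (ba_ext X) n) : term (ba_ext X) n :=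
  @tapp (ba_ext X) n (inl ba_meet) (fun k : 'I_2 => if k == ord0 then a else b).
Definition bcompl n (a : term (ba_ext X) n) : term (ba_ext X) n :=
  @tapp (ba_ext X) n (inl ba_compl) (fun _ : 'I_1 => a).
Definition bfin n (a : term (ba_ext X) n) : formula (ba_ext X) n :=
  @frel (ba_ext X) n (inl tt) (fun _ : 'I_1 => a).

Definition everywhere n (phi : formula L n) : fv_form n :=
  FVForm (feq (tvar (ord0 : 'I_1)) (bone 1)) (fun _ => phi).

Definition form_not n (x : fv_form n) : fv_form n :=
  FVForm (fnot (form_psi x)) (@form_phi n x).

(** Shifting the variables of the second [psi] would alter its code throughout, so it goes through
    [fsubst] instead. The quantifiers this adds are harmless: they stay inside the symbol. *)
Definition form_and n (x y : fv_form n) : fv_form n :=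
  FVForm
    (fand (fren (form_psi x) (@lshift _ (form_size y)))
          (fsubst (fun j => tvar (rshift (form_size x) j)) (form_psi y)))
    (vcat (@form_phi n x) (@form_phi n y)).

(** In a pair [(T, F)] of the result, the value of [T] is [[F]] as soon as
    the value of each variable [j] is [[phi j]]. *)
Fixpoint sign_conditions M n (phi : 'I_M -> formula L n) (s : seq 'I_M)
    (T : term (ba_ext X) M) (F : formula L n) :
    seq (term (ba_ext X) M * formula L n) :=
  if s is j :: s' then
    sign_conditions phi s' (bmeet T (tvar j)) (fand F (phi j)) ++
    sign_conditions phi s' (bmeet T (bcompl (tvar j))) (fand F (fnot (phi j)))
  else [:: (T, F)].

(** Inside [fexs] the variables are first the [Z_j], the last one standing for [~ Phi(y)], then one
    [u_T] per sign condition. [T <= u_T] is written as an equation between the meet of both and [T];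
    [y = y] is the true formula from which the sign conditions grow. *)
Definition form_ex (Phi : formula L 1) n (x : fv_form n.+1) : fv_form n :=
  let m := form_size x in
  let phi := vcat (@form_phi _ x) (fun _ : 'I_1 => fnot (fren Phi (fun _ => ord0))) in
  let s := sign_conditions phi (enum 'I_(m + 1)) (bone _) (feq (tvar ord0) (tvar ord0)) in
  let P := tnth (in_tuple s) in
  FVForm
    (fexs (fands
       (fun i => let T := tren (@lshift (m + 1) (size s)) (P i).1 in
                 feq (bmeet T (tvar (rshift (m + 1) i))) T)
       (fand (fren (form_psi x) (fun j => lshift (size s) (lshift 1 j)))
             (bfin (tvar (lshift (size s) (rshift m ord0)))))
       (enum 'I_(size s))))
    (fun i => fex (P i).2).

Fixpoint term_fv n (t : term (fv_lang L X) n) : term L n :=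
  match t with
  | tvar i => tvar i
  | tapp F a => @tapp L n F (fun k => term_fv (a k))
  end.

Fixpoint to_form (Phi : formula L 1) n (theta : formula (fv_lang L X) n) : fv_form n :=
  match theta with
  | feq n t u => everywhere (feq (term_fv t) (term_fv u))
  | Defs.frel n R a =>
      match R return ('I_(@rarity (fv_lang L X) R) -> term (fv_lang L X) n) -> fv_form n with
      | inl R => fun a => everywhere (frel R (fun k => term_fv (a k)))
      | inr s => fun a =>
          FVForm (fv_psi s) (fun j => fsubst (fun k => term_fv (a k)) (fv_phi s j))
      end a
  | fnot _ a => form_not (to_form Phi a)
  | fand _ a b => form_and (to_form Phi a) (to_form Phi b)
  | fex _ a => form_ex Phi (to_form Phi a)
  end.

Definition form_formula n (x : fv_form n) : formula (fv_lang L X) n :=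
  @frel (fv_lang L X) n (inr (FVSym (form_psi x) (@form_phi n x))) (@tvar _ n).

(** * Truth of normal forms in the full and the restricted product *)

Section Semantics.
Variables (I : Type) (B : interp (ba_ext X) (set I)) (hB : powerset_structure B).
Variables (M : I -> Type) (A : forall i, interp L (M i)).

(** Tuples range over the full product; membership in the restricted product enters only through the
    quantifier. *)
Definition form_sat n (x : fv_form n) (f : 'I_n -> forall i, M i) : Prop :=
  sat B (form_psi x) (fun j => truth_set A (form_phi j) f).

Lemma teval_bmeet n (v : 'I_n -> set I) a b :
  teval B v (bmeet a b) = teval B v a `&` teval B v b.
Proof. by rewrite /= (ps_meet hB). Qed.

Lemma teval_bcompl n (v : 'I_n -> set I) a :
  teval B v (bcompl a) = ~` teval B v a.
Proof. by rewrite /= (ps_compl hB). Qed.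

Lemma teval_bone n (v : 'I_n -> set I) : teval B v (bone n) = setT.
Proof. by rewrite /= (ps_one hB). Qed.

Lemma sat_bfin n (v : 'I_n -> set I) a :
  sat B (bfin a) v <-> finite_set (teval B v a).
Proof. exact: (ps_fin hB). Qed.

Lemma form_sat_everywhere n (phi : formula L n) f :
  form_sat (everywhere phi) f <-> forall i, sat (A i) phi (fun k => f k i).
Proof.
rewrite /form_sat /= (ps_one hB).
split=> [h i|h]; last by apply/seteqP; split=> // i _; exact: h.
by have : truth_set A phi f i by move: h => /= ->.
Qed.

Lemma form_sat_and n (x y : fv_form n) f :
  form_sat (form_and x y) f <-> form_sat x f /\ form_sat y f.
Proof.
rewrite /form_sat /= sat_fren sat_fsubst /=.
by under eq_fun do rewrite vcat_lshift; under [in X in _ /\ X]eq_fun do rewrite vcat_rshift.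
Qed.

Lemma truth_set_vcons n (phi : formula L n.+1) f y i :
  truth_set A phi (vcons y f) i <-> sat (A i) phi (vcons (y i) (fun k => f k i)).
Proof. by rewrite /truth_set /= (vcons_comp (fun g : forall i, M i => g i)). Qed.

(** When the [Z j] come from an actual [y], each step cuts [T] and strengthens [F] by the same
    condition, so the inclusion persists. *)
Lemma sign_conditions_sound K n (phi : 'I_K -> formula L n.+1) f y s T F :
  let Z j := truth_set A (phi j) (vcons y f) in
  teval B Z T `<=` truth_set A F (vcons y f) ->
  forall p, List.In p (sign_conditions phi s T F) ->
    teval B Z p.1 `<=` truth_set A p.2 (vcons y f).
Proof.
move=> Z; elim: s T F => [|j s IH] T F hTF p /=; first by case=> [<-|].
move=> /(@List.in_app_or _ _ _ _)[] hp; apply: (IH _ _ _ p hp) => i;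
  rewrite ?teval_bmeet ?teval_bcompl => -[Ti Zi].
- by split; [exact: hTF|].
- by split; [exact: hTF|].
Qed.

(** Here the sets [Z j] are arbitrary. Taking at each [j] the branch that contains [i] leads to a
    combination whose formula prescribes the truth of every [phi j] as [Z] does at [i]. *)
Lemma sign_conditions_complete K n (phi : 'I_K -> formula L n) (Z : 'I_K -> set I) i s T F :
  teval B Z T i ->
  exists2 p, List.In p (sign_conditions phi s T F) &
    teval B Z p.1 i /\
    forall w, sat (A i) p.2 w ->
      sat (A i) F w /\ forall j, j \in s -> sat (A i) (phi j) w <-> Z j i.
Proof.
elim: s T F => [|j s IH] T F Ti /=; first by exists (T, F); [left|split].
have [Zi|nZi] := pselect (Z j i).
- have [|p hp [pi hw]] := IH (bmeet T (tvar j)) (fand F (phi j)).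
    by rewrite teval_bmeet.
  exists p; first by apply/List.in_or_app; left.
  split=> // w /hw[[hF hj] hs]; split=> // k; rewrite inE => /predU1P[->|/hs//].
  by split.
- have [|p hp [pi hw]] := IH (bmeet T (bcompl (tvar j))) (fand F (fnot (phi j))).
    by rewrite teval_bmeet teval_bcompl.
  exists p; first by apply/List.in_or_app; right.
  split=> // w /hw[[hF hj] hs]; split=> // k; rewrite inE => /predU1P[->|/hs//].
  by split.
Qed.

(** Pairs of terms and formulas need not have decidable equality, hence [List.In]; the index found
    here is the number of the variable [u_T]. *)
Lemma in_tnth (T : Type) (s : seq T) p :
  List.In p s <-> exists i, tnth (in_tuple s) i = p.
Proof.
have e := map_tnth_enum (in_tuple s).
rewrite -[X in List.In _ X]e List.in_map_iff; split=> -[i hi]; exists i; first by case: hi.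
split=> //; move: (mem_enum 'I_(size s) i); elim: (enum _) => //= j r IH.
by rewrite inE => /predU1P[->|/IH]; [left|right].
Qed.

(** This removes the syntax: [w] collects the values of the quantified [Z_j], and each equation
    becomes an inclusion by [setIidPl]. *)
Lemma form_sat_exE (Phi : formula L 1) n (x : fv_form n.+1) f :
  let m := form_size x in
  let phi := vcat (@form_phi _ x) (fun _ : 'I_1 => fnot (fren Phi (fun _ => ord0))) in
  let s := sign_conditions phi (enum 'I_(m + 1)) (bone _) (feq (tvar ord0) (tvar ord0)) in
  form_sat (form_ex Phi x) f <->
  exists w : 'I_(m + 1) -> set I,
    [/\ forall p, List.In p s -> teval B w p.1 `<=` truth_set A (fex p.2) f,
        sat B (form_psi x) (fun j => w (lshift 1 j)) &
        finite_set (w (rshift m ord0))].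
Proof.
move=> m phi s; rewrite /form_sat /form_ex -/m -/phi -/s; cbn [form_psi form_phi form_size].
set U := fun j => truth_set _ _ _.
have wl (w : 'I_(m + 1) -> set I) : (fun j => vcat w U (lshift (size s) j)) = w.
  by apply/funext => j; rewrite vcat_lshift.
rewrite sat_fexs; have fin_w w := sat_bfin (vcat w U) (tvar (lshift (size s) (rshift m ord0))).
have psi_w (w : 'I_(m + 1) -> set I) :
    (fun j : 'I_m => vcat w U (lshift (size s) (lshift 1 j))) = (fun j => w (lshift 1 j)).
  by apply/funext => j; rewrite vcat_lshift.
split=> -[w H]; exists w.
- move: H; rewrite sat_fands sat_fand sat_fren psi_w fin_w /= vcat_lshift => -[hT [hpsi hf]].
  split=> // p /in_tnth[i <-]; have := hT i (mem_enum _ i).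
  by rewrite /= (ps_meet hB) /= vcat_rshift teval_tren wl => /setIidPl.
- case: H => hs hpsi hf.
  rewrite sat_fands sat_fand sat_fren psi_w fin_w /= vcat_lshift; split=> // i _.
  rewrite /= (ps_meet hB) /= vcat_rshift teval_tren wl; apply/setIidPl.
  by apply: hs; apply/in_tnth; exists i.
Qed.

Lemma form_sat_ex (Phi : formula L 1) n (x : fv_form n.+1) f :
  form_sat (form_ex Phi x) f <->
  exists2 y, restricted A Phi y & form_sat x (vcons y f).
Proof.
have eP y : truth_set A (fnot (fren Phi (fun _ => ord0))) (vcons y f) =
            truth_set A (fnot Phi) (fun _ => y).
  by apply/seteqP; split=> i; rewrite /truth_set /= sat_fren vcons0.
pose phi := vcat (@form_phi _ x) (fun _ : 'I_1 => fnot (fren Phi (fun _ => ord0))).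
rewrite form_sat_exE -/phi; split=> [[w [hs hpsi hf]]|[y hy hx]].
(* The combinations cover every index, since they start from [1]. The one containing [i] lies in the
   truth set of its [exists y, F], which supplies a coordinate at [i]; choosing one at each index
   builds [y]. *)
- have hy i : {y | forall j, sat (A i) (phi j) (vcons y (fun k => f k i)) <-> w j i}.
    apply: cid.
    have Ti : teval B w (bone (form_size x + 1)) i by rewrite teval_bone.
    have [p hp [pi hw]] :=
      sign_conditions_complete phi (enum 'I_(form_size x + 1)) (feq (tvar ord0) (tvar ord0)) Ti.
    have [y hyp] := hs p hp i pi; have [_ hj] := hw _ hyp.
    by exists y => j; apply: hj; rewrite mem_enum.
  pose y i := projT1 (hy i).
  have ey j : truth_set A (phi j) (vcons y f) = w j.
    by apply/seteqP; split=> i; rewrite truth_set_vcons; apply (projT2 (hy i) j).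
  exists y.
    (* The last [phi] is [~ Phi(y)], so its prescribed set is the finite one. *)
    by rewrite /restricted /= -eP; have := ey (rshift _ ord0); rewrite /phi vcat_rshift => ->.
  rewrite /form_sat.
  suff -> : (fun j => truth_set A (form_phi j) (vcons y f)) = (fun j => w (lshift 1 j)) by [].
  by apply/funext => j; rewrite -ey /phi vcat_lshift.
- exists (fun j => truth_set A (phi j) (vcons y f)); split.
  + move=> p hp i pi; exists (y i); apply/truth_set_vcons.
    (* The coordinate of [y] itself witnesses [exists y, F]; the initial inclusion holds because
       [y = y] is true everywhere. *)
    by apply: (sign_conditions_sound _ hp) pi => k _.
  + by rewrite /phi; under eq_fun do rewrite vcat_lshift.
  + by rewrite /phi vcat_rshift eP.
Qed.

Variables (Phi : formula L 1).
Hypothesis hPhi : forall i, substructure (A i) (definable (A i) Phi).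

Lemma teval_term_fv n (t : term (fv_lang L X) n) v i :
  sval (teval (restricted_interp B hPhi) v t) i =
  teval (A i) (fun k => sval (v k) i) (term_fv t).
Proof.
elim: t => //= F a IH; congr fun_of; apply/funext => k; exact: IH.
Qed.

(** Atoms of the substructure are evaluated in the full product, so only [fex] sees the restriction:
    the side condition of [form_sat_ex] is the membership proof carried by an element of the
    restricted product. *)
Lemma sat_to_form n (theta : formula (fv_lang L X) n) v :
  sat (restricted_interp B hPhi) theta v <->
  form_sat (to_form Phi theta) (fun k => sval (v k)).
Proof.
elim: theta v => {n} [n t u|n [R|s] a|n a IH|n a IHa b IHb|n a IH] v.
- rewrite form_sat_everywhere /=; split=> [tu i|tu].
    by rewrite -!teval_term_fv tu.
  (* Two elements of the restricted product agree once their coordinates do; the membership proofs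
     are identified by proof irrelevance. *)
  have : sval (teval (restricted_interp B hPhi) v t) = sval (teval (restricted_interp B hPhi) v u).
    by apply: functional_extensionality_dep => i; rewrite !teval_term_fv.
  case: (teval _ _ t) => x hx; case: (teval _ _ u) => y hy /= xy.
  by subst y; congr exist; exact: Prop_irrelevance.
- have e i : (fun k => sval (teval (restricted_interp B hPhi) v (a k)) i) =
      (fun k => teval (A i) (fun k => sval (v k) i) (term_fv (a k))).
    by apply/funext => k; exact: teval_term_fv.
  rewrite form_sat_everywhere; split=> h i; have := h i; by rewrite /= -e.
- rewrite /form_sat /=.
  suff -> : (fun j => truth_set A (fsubst (fun k => term_fv (a k)) (fv_phi s j))
                        (fun k => sval (v k))) =
    (fun j => truth_set A (fv_phi s j)
                (fun k => sval (teval (restricted_interp B hPhi) v (a k)))) by [].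
  apply/funext => j; apply/seteqP; split=> i; rewrite /truth_set /= sat_fsubst;
    by have -> : (fun k => sval (teval (restricted_interp B hPhi) v (a k)) i) =
      (fun k => teval (A i) (fun k => sval (v k) i) (term_fv (a k)));
    first by apply/funext => k; exact: teval_term_fv.
- by rewrite /= IH.
- by rewrite form_sat_and /= IHa IHb.
- rewrite form_sat_ex /=; split=> [[y hy]|[y hy hx]].
    exists (sval y); first exact: svalP.
    by move: hy; rewrite IH (vcons_comp (fun z : {f | restricted A Phi f} => sval z)).
  exists (exist _ y hy).
  by rewrite IH (vcons_comp (fun z : {f | restricted A Phi f} => sval z)).
Qed.

End Semantics.
End NormalForm.

(** * The program *)

Local Notation hd := EHd.
Local Notation tl := ETl.
Local Notation num k := (EQuote (Atom k)).
Local Notation "a ::: b" := (ECons a b) (at level 60, right associativity).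

Local Notation f_out := 1.
Local Notation f_vars := 2.
Local Notation f_form := 3.
Local Notation f_not := 4.
Local Notation f_substs := 5.
Local Notation f_subst := 6.
Local Notation f_exs := 7.
Local Notation f_eqs := 8.
Local Notation f_shift := 9.
Local Notation f_shifts := 10.
Local Notation f_add := 11.
Local Notation f_size := 12.
Local Notation f_and := 13.
Local Notation f_cat := 14.
Local Notation f_ex := 15.
Local Notation f_ex_signs := 16.
Local Notation f_ex_form := 17.
Local Notation f_signs := 18.
Local Notation f_covers := 19.
Local Notation f_ex_all := 20.

Definition s_tvar (i : sexp) : sexp := Cons (Atom 0) i.
(** In [Cons (Atom 0) (Atom k)] the first atom marks a symbol of the Boolean part; for functions [k]
    is its number in [code_ba_fsym]. *)
Definition s_meet (a b : sexp) : sexp :=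
  Cons (Atom 1) (Cons (Cons (Atom 0) (Atom 2)) (slist [:: a; b])).
Definition s_compl (a : sexp) : sexp :=
  Cons (Atom 1) (Cons (Cons (Atom 0) (Atom 4)) (slist [:: a])).
Definition s_one : sexp := Cons (Atom 1) (Cons (Cons (Atom 0) (Atom 1)) (Atom 0)).
Definition s_eq (a b : sexp) : sexp := Cons (Atom 0) (Cons a b).
Definition s_fin (a : sexp) : sexp :=
  Cons (Atom 1) (Cons (Cons (Atom 0) (Atom 0)) (slist [:: a])).
Definition s_and (a b : sexp) : sexp := Cons (Atom 3) (Cons a b).

Local Notation e_var i := (num 0 ::: i).
Local Notation e_meet a b := (num 1 ::: EQuote (Cons (Atom 0) (Atom 2)) ::: a ::: b ::: num 0).
Local Notation e_compl a := (num 1 ::: EQuote (Cons (Atom 0) (Atom 4)) ::: a ::: num 0).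
Local Notation e_eq a b := (num 0 ::: a ::: b).
Local Notation e_and a b := (num 3 ::: a ::: b).
Local Notation e_everywhere x := (EQuote (s_eq (s_tvar (Atom 0)) s_one) ::: x ::: num 0).

(** Each comment gives the shape of the argument. *)
Definition qe_program : program := [::
  (* (Phi n theta) *)
  ECall f_out (hd (tl EArg) ::: ECall f_form (hd EArg ::: hd (tl (tl EArg))));
  (* (n psi . phis) *)
  num 1 ::: (num 1 ::: hd EArg ::: hd (tl EArg) ::: tl (tl EArg) ::: num 0) :::
    ECall f_vars (num 0 ::: hd EArg ::: num 0);
  (* (m n . acc) *)
  EIf (hd (tl EArg))
    (ECall f_vars (hd EArg ::: EPred (hd (tl EArg)) :::
       e_var (ECall f_add (hd EArg ::: EPred (hd (tl EArg)))) ::: tl (tl EArg)))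
    (tl (tl EArg));
  (* (Phi . theta) *)
  EIf (EEqAtom (hd (tl EArg)) (num 4))
    (ECall f_ex (hd EArg ::: ECall f_form (hd EArg ::: tl (tl EArg))))
  (EIf (EEqAtom (hd (tl EArg)) (num 3))
    (ECall f_and (ECall f_form (hd EArg ::: hd (tl (tl EArg))) :::
                  ECall f_form (hd EArg ::: tl (tl (tl EArg)))))
  (EIf (EEqAtom (hd (tl EArg)) (num 2))
    (ECall f_not (ECall f_form (hd EArg ::: tl (tl EArg))))
  (* The remaining tags are 1 for a relation and 0 for an equation. A relation symbol carries a
     second tag: nonzero for a new symbol, zero for a basic one, which is stripped. *)
  (EIf (hd (tl EArg))
    (EIf (hd (hd (tl (tl EArg))))
       (hd (tl (tl (hd (tl (tl EArg))))) :::
        ECall f_substs (tl (tl (tl EArg)) ::: hd (tl (tl (tl (hd (tl (tl EArg))))))))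
       (e_everywhere (num 1 ::: tl (hd (tl (tl EArg))) ::: tl (tl (tl EArg)))))
    (e_everywhere (tl EArg)))));
  (* (psi . phis) *)
  (num 2 ::: hd EArg) ::: tl EArg;
  (* (ts . phis) *)
  EIf (EIsAtom (tl EArg)) (num 0)
    (ECall f_subst (hd EArg ::: hd (tl EArg)) ::: ECall f_substs (hd EArg ::: tl (tl EArg)));
  (* (ts . phi) *)
  ECall f_exs (hd EArg ::: ECall f_eqs ((ECall f_size (hd EArg) ::: num 0) ::: EArg));
  (* (ts . phi) *)
  EIf (EIsAtom (hd EArg)) (tl EArg) (num 4 ::: ECall f_exs (tl (hd EArg) ::: tl EArg));
  (* ((k . j) ts . phi) *)
  EIf (EIsAtom (hd (tl EArg))) (tl (tl EArg))
    (e_and (e_eq (e_var (tl (hd EArg)))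
                 (ECall f_shift (hd (hd EArg) ::: hd (hd (tl EArg)))))
       (ECall f_eqs ((hd (hd EArg) ::: ESucc (tl (hd EArg))) :::
                     tl (hd (tl EArg)) ::: tl (tl EArg))));
  (* (k . t) *)
  EIf (hd (tl EArg))
    (num 1 ::: hd (tl (tl EArg)) ::: ECall f_shifts (hd EArg ::: tl (tl (tl EArg))))
    (num 0 ::: ECall f_add (hd EArg ::: tl (tl EArg)));
  (* (k . ts) *)
  EIf (EIsAtom (tl EArg)) (num 0)
    (ECall f_shift (hd EArg ::: hd (tl EArg)) ::: ECall f_shifts (hd EArg ::: tl (tl EArg)));
  (* (k . i) *)
  EIf (hd EArg) (ESucc (ECall f_add (EPred (hd EArg) ::: tl EArg))) (tl EArg);
  (* l *)
  EIf (EIsAtom EArg) (num 0) (ESucc (ECall f_size (tl EArg)));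
  (* ((psi1 . phis1) psi2 . phis2) *)
  e_and (hd (hd EArg))
    (ECall f_subst
      (ECall f_vars (ECall f_size (tl (hd EArg)) :::
                     ECall f_size (tl (tl EArg)) ::: num 0) ::: hd (tl EArg)))
    ::: ECall f_cat (tl (hd EArg) ::: tl (tl EArg));
  (* (l1 . l2) *)
  EIf (EIsAtom (hd EArg)) (tl EArg)
    (hd (hd EArg) ::: ECall f_cat (tl (hd EArg) ::: tl EArg));
  (* (Phi psi . phis) *)
  ECall f_ex_signs
    (tl EArg ::: ECall f_cat (tl (tl EArg) ::: (num 2 ::: hd EArg) ::: num 0));
  (* ((psi . phis) . phis') *)
  ECall f_ex_form (EArg ::: ECall f_signs
    ((tl EArg ::: num 0) :::
     (EQuote s_one ::: EQuote (s_eq (s_tvar (Atom 0)) (s_tvar (Atom 0)))) ::: num 0));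
  (* (((psi . phis) . phis') . signs) *)
  ECall f_exs (tl (hd EArg) :::
    ECall f_covers (ECall f_size (tl (hd EArg)) ::: tl EArg :::
      e_and (hd (hd (hd EArg)))
        (num 1 ::: EQuote (Cons (Atom 0) (Atom 0)) :::
         e_var (ECall f_size (tl (hd (hd EArg)))) ::: num 0)))
    ::: ECall f_ex_all (tl EArg);
  (* ((phis . j) (T . F) . acc) *)
  EIf (EIsAtom (hd (hd EArg))) (hd (tl EArg) ::: tl (tl EArg))
    (ECall f_signs ((tl (hd (hd EArg)) ::: ESucc (tl (hd EArg))) :::
      (e_meet (hd (hd (tl EArg))) (e_var (tl (hd EArg))) :::
       e_and (tl (hd (tl EArg))) (hd (hd (hd EArg)))) :::
      ECall f_signs ((tl (hd (hd EArg)) ::: ESucc (tl (hd EArg))) :::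
        (e_meet (hd (hd (tl EArg))) (e_compl (e_var (tl (hd EArg)))) :::
         e_and (tl (hd (tl EArg))) (num 2 ::: hd (hd (hd EArg)))) :::
        tl (tl EArg))));
  (* (j signs . psi) *)
  EIf (EIsAtom (hd (tl EArg))) (tl (tl EArg))
    (e_and (e_eq (e_meet (hd (hd (hd (tl EArg)))) (e_var (hd EArg))) (hd (hd (hd (tl EArg)))))
      (ECall f_covers (ESucc (hd EArg) ::: tl (hd (tl EArg)) ::: tl (tl EArg))));
  (* signs *)
  EIf (EIsAtom EArg) (num 0) ((num 4 ::: tl (hd EArg)) ::: ECall f_ex_all (tl EArg))
].

Local Arguments body : simpl never.
Local Notation run k x y := (evals qe_program x (body qe_program k) y).

(** One rule for both outcomes: the branch is selected after evaluation of the test has determined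
    [k]. *)
Lemma ev_if p x e e1 e2 k y :
  evals p x e (Atom k) -> evals p x (if k is 0 then e2 else e1) y ->
  evals p x (EIf e e1 e2) y.
Proof. by case: k => [|k]; [apply: ev_if_false | apply: ev_if_true]. Qed.

(** Evaluates the body of a function, leaving its calls as subgoals. *)
Ltac eval_expr :=
  lazymatch goal with
  | |- evals _ _ EArg _ => apply ev_arg
  | |- evals _ _ (EQuote _) _ => apply ev_quote
  | |- evals _ _ (ECons _ _) _ => eapply ev_cons; [eval_expr | eval_expr]
  | |- evals _ _ (EHd _) _ => eapply ev_hd; eval_expr
  | |- evals _ _ (ETl _) _ => eapply ev_tl; eval_expr
  | |- evals _ _ (EIsAtom _) _ => eapply ev_isatom; eval_expr
  | |- evals _ _ (EEqAtom _ _) _ => eapply ev_eqatom; [eval_expr | eval_expr]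
  | |- evals _ _ (ESucc _) _ => eapply ev_succ; eval_expr
  | |- evals _ _ (EPred _) _ => eapply ev_pred; eval_expr
  | |- evals _ _ (EIf _ _ _) _ =>
      eapply ev_if; [eval_expr | lazymatch goal with |- evals ?p ?x ?e ?y =>
        let e' := eval hnf in e in change (evals p x e' y); eval_expr end]
  | |- evals _ _ (ECall _ _) _ => eapply ev_call; [eval_expr |]
  end.

Ltac eval_body :=
  lazymatch goal with |- evals ?p ?x (body ?p ?k) ?y =>
    let e := eval hnf in (body p k) in change (evals p x e y); eval_expr
  end.

Lemma run_add k i : run f_add (Cons (Atom k) (Atom i)) (Atom (k + i)).
Proof. by elim: k => [|k IH]; eval_body. Qed.

Lemma run_size l : run f_size (slist l) (Atom (size l)).
Proof. by elim: l => [|x l IH]; eval_body. Qed.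

Lemma run_cat l1 l2 : run f_cat (Cons (slist l1) (slist l2)) (slist (l1 ++ l2)).
Proof. by elim: l1 => [|x l IH]; eval_body. Qed.

Lemma run_vars m n l :
  run f_vars (Cons (Atom m) (Cons (Atom n) (slist l)))
    (slist ([seq s_tvar (Atom i) | i <- iota m n] ++ l)).
Proof.
elim: n l => [|n IH] l; eval_body; first exact: run_add.
(* The program counts down, so the last variable, [m + n], enters the accumulator first. *)
have -> : iota m n.+1 = iota m n ++ [:: m + n] by rewrite -addn1 iotaD.
rewrite map_cat -catA.
exact: (IH (s_tvar (Atom (m + n)) :: l)).
Qed.

(** The list serves only as a unary counter for the quantifiers. *)
Lemma run_exs l x : run f_exs (Cons (slist l) x) (iter (size l) (Cons (Atom 4)) x).
Proof. by elim: l => [|y l IH]; eval_body. Qed.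

(** * Runs on terms and substitutions *)

Section TermCodes.
Variables (L : language) (c : coding L).

Lemma run_shift k n (t : term L n) :
  run f_shift (Cons (Atom k) (code_term c t)) (code_term c (tren (@rshift k n) t)).
Proof.
elim: t => [i|F a IH]; eval_body; first exact: run_add.
by elim: (enum _) => [|j s IHs]; eval_body; [exact: IH | exact: IHs].
Qed.

(** The hypothesis makes [s] a stretch of consecutive variables, so the counter [j] always names the
    head of the list. *)
Lemma run_eqs k n (t : 'I_k -> term L n) (s : seq 'I_k) j phi :
  map (@nat_of_ord k) s = iota j (size s) ->
  run f_eqs (Cons (Cons (Atom k) (Atom j)) (Cons (slist [seq code_term c (t i) | i <- s]) phi))
    (foldr (fun i : 'I_k => s_and (s_eq (s_tvar (Atom i)) (code_term c (tren (@rshift k n) (t i)))))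
       phi s).
Proof.
elim: s j => [|i s IH] j; first by move=> _; eval_body.
by move=> [<- hs]; eval_body; [exact: run_shift | exact: IH].
Qed.

Lemma run_subst k n (t : 'I_k -> term L n) (phi : formula L k) :
  run f_subst
    (Cons (slist [seq code_term c (t i) | i <- enum 'I_k]) (code_formula c phi))
    (code_formula c (fsubst t phi)).
Proof.
rewrite code_fexs code_fands code_fren //; eval_body.
- exact: run_size.
- by rewrite size_map size_enum_ord; apply: run_eqs; rewrite map_nat_enum_ord size_enum_ord.
- by rewrite -[in iter k](size_enum_ord k) -(size_map (fun i => code_term c (t i))); exact: run_exs.
Qed.

Lemma run_substs k n (t : 'I_k -> term L n) m (phi : 'I_m -> formula L k) :
  run f_substs
    (Cons (slist [seq code_term c (t i) | i <- enum 'I_k])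
          (slist [seq code_formula c (phi j) | j <- enum 'I_m]))
    (slist [seq code_formula c (fsubst t (phi j)) | j <- enum 'I_m]).
Proof.
by elim: (enum 'I_m) => [|j s IH]; eval_body; [exact: run_subst | exact: IH].
Qed.

End TermCodes.

(** * Runs on normal forms and the whole elimination *)

Section FormulaCodes.
Variables (L X : language) (cL : coding L) (cX : coding X).
Local Notation cB := (ba_ext_coding cX).
Local Notation cF := (fv_coding cL cX).

Lemma code_bone n : code_term cB (bone X n) = s_one.
Proof. by rewrite /bone /= enum_ord0. Qed.

Lemma code_bmeet n (a b : term (ba_ext X) n) :
  code_term cB (bmeet a b) = s_meet (code_term cB a) (code_term cB b).
Proof. by rewrite /bmeet /= !enum_ordSl enum_ord0. Qed.

Lemma code_bcompl n (a : term (ba_ext X) n) :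
  code_term cB (bcompl a) = s_compl (code_term cB a).
Proof. by rewrite /bcompl /= !enum_ordSl enum_ord0. Qed.

Lemma code_bfin n (a : term (ba_ext X) n) :
  code_formula cB (bfin a) = s_fin (code_term cB a).
Proof. by rewrite /bfin /= !enum_ordSl enum_ord0. Qed.

(** The arity [n] is left out; the program takes it from its input when it builds the final atom. *)
Definition code_form n (x : fv_form L X n) : sexp :=
  Cons (code_formula cB (form_psi x))
    (slist [seq code_formula cL (form_phi j) | j <- enum 'I_(form_size x)]).

Definition code_sign n K (p : term (ba_ext X) K * formula L n) : sexp :=
  Cons (code_term cB p.1) (code_formula cL p.2).

Lemma code_vcat n k m (phi : 'I_k -> formula L n) (phi' : 'I_m -> formula L n) :
  [seq code_formula cL (vcat phi phi' j) | j <- enum 'I_(k + m)] =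
  [seq code_formula cL (phi j) | j <- enum 'I_k] ++
  [seq code_formula cL (phi' j) | j <- enum 'I_m].
Proof.
rewrite enum_ordD map_cat -(map_comp _ (@lshift k m)) -(map_comp _ (@rshift k m)).
by congr (_ ++ _); apply: eq_map => j /=; rewrite ?vcat_lshift ?vcat_rshift.
Qed.

Lemma code_everywhere n (phi : formula L n) :
  code_form (everywhere X phi) =
  Cons (s_eq (s_tvar (Atom 0)) s_one) (Cons (code_formula cL phi) (Atom 0)).
Proof. by rewrite /code_form /everywhere /= !enum_ordSl !enum_ord0. Qed.

Lemma code_term_fv n (t : term (fv_lang L X) n) :
  code_term cL (term_fv t) = code_term cF t.
Proof.
elim: t => //= F a IH; congr (Cons _ (Cons _ (slist _))).
by apply: eq_map => k; exact: IH.
Qed.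

Lemma run_form_and n (x y : fv_form L X n) :
  run f_and (Cons (code_form x) (code_form y)) (code_form (form_and x y)).
Proof.
rewrite /code_form /= code_fren // code_vcat; eval_body.
- exact: run_size.
- exact: run_size.
- exact: (run_vars _ _ [::]).
- rewrite !size_map_enum_ord cats0.
  have -> : [seq s_tvar (Atom i) | i <- iota (form_size x) (form_size y)] =
      [seq code_term cB (tvar (rshift (form_size x) j)) | j <- enum 'I_(form_size y)].
    rewrite -[X in iota X]addn0 iotaDl -(map_nat_enum_ord (form_size y)).
    by rewrite -!(map_comp _ (@nat_of_ord _)) -map_comp.
  exact: run_subst.
- exact: run_cat.
Qed.

(** The accumulator replaces concatenation: the negative half is computed first and becomes the
    accumulator of the positive half. *)
Lemma run_signs K n (phi : 'I_K -> formula L n) (s : seq 'I_K) j T F acc :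
  map (@nat_of_ord K) s = iota j (size s) ->
  run f_signs
    (Cons (Cons (slist [seq code_formula cL (phi i) | i <- s]) (Atom j))
       (Cons (code_sign (T, F)) (slist acc)))
    (slist (map (@code_sign _ _) (sign_conditions phi s T F) ++ acc)).
Proof.
elim: s j T F acc => [|i s IH] j T F acc; first by move=> _; eval_body.
move=> [<- hs]; rewrite /sign_conditions -/sign_conditions map_cat -catA; eval_body.
- have := IH _ (bmeet T (bcompl (tvar i))) (fand F (fnot (phi i))) acc hs.
  by rewrite /code_sign code_bmeet code_bcompl; exact.
- have := IH _ (bmeet T (tvar i)) (fand F (phi i)) _ hs.
  by rewrite /code_sign code_bmeet; exact.
Qed.

(** The [Z_j] occupy the first [K] variables, so [u_T] for the [i]-th condition is variable
    [K + i]. *)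
Lemma run_covers K n N (P : 'I_N -> term (ba_ext X) K * formula L n) s j psi :
  [seq K + i | i : 'I_N <- s] = iota j (size s) ->
  run f_covers (Cons (Atom j) (Cons (slist [seq code_sign (P i) | i <- s]) psi))
    (foldr (fun i : 'I_N =>
              s_and (s_eq (s_meet (code_term cB (P i).1) (s_tvar (Atom (K + i))))
                          (code_term cB (P i).1))) psi s).
Proof.
elim: s j => [|i s IH] j; first by move=> _; eval_body.
by move=> [<- hs]; eval_body; exact: IH.
Qed.

Lemma run_ex_all K n (s : seq (term (ba_ext X) K * formula L n.+1)) :
  run f_ex_all (slist (map (@code_sign _ _) s))
    (slist [seq code_formula cL (fex p.2) | p <- s]).
Proof. by elim: s => [|p s IH]; eval_body. Qed.

Lemma run_form_ex Phi n (x : fv_form L X n.+1) :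
  run f_ex (Cons (code_formula cL Phi) (code_form x)) (code_form (form_ex Phi x)).
Proof.
pose m := form_size x.
pose phi := vcat (@form_phi _ _ _ x) (fun _ : 'I_1 => fnot (fren Phi (fun _ => ord0))).
pose s := sign_conditions phi (enum 'I_(m + 1)) (bone X _) (feq (tvar ord0) (tvar ord0)).
have ephi : [seq code_formula cL (form_phi j) | j <- enum 'I_m] ++
    [:: Cons (Atom 2) (code_formula cL Phi)] =
    [seq code_formula cL (phi j) | j <- enum 'I_(m + 1)].
  rewrite code_vcat; congr (_ ++ _).
  (* The only variable of [Phi] is 0 and is sent to 0, so [Phi(y)] has the code of [Phi]. *)
  by rewrite !enum_ordSl enum_ord0 /= code_fren // => i; rewrite ord1.
have es : map (@code_sign _ _) s =
    [seq code_sign (tnth (in_tuple s) i) | i <- enum 'I_(size s)].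
  by rewrite (map_comp _ (tnth (in_tuple s))) map_tnth_enum.
have eand k (a b : formula (ba_ext X) k) :
    code_formula cB (fand a b) = s_and (code_formula cB a) (code_formula cB b) by [].
rewrite /code_form /form_ex -/m -/phi -/s; cbn [form_psi form_phi form_size].
rewrite code_fexs code_fands eand code_bfin code_fren //.
eval_body.
- exact: (run_cat _ [:: _]).
eval_body.
- rewrite ephi; have := @run_signs _ _ phi (enum _) 0 (bone X _)
    (feq (tvar ord0) (tvar ord0)) [::] _.
  rewrite /code_sign code_bone; apply; by rewrite map_nat_enum_ord size_enum_ord.
rewrite cats0 ephi; eval_body.
- exact: run_size.
- exact: run_size.
- rewrite !size_map_enum_ord es.
  apply: run_covers.
  rewrite size_enum_ord -[X in iota X]addn0 iotaDl -map_nat_enum_ord.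
  by rewrite -(map_comp _ (@nat_of_ord _)).
- have := run_exs [seq code_formula cL (phi j) | j <- enum 'I_(m + 1)].
  rewrite size_map_enum_ord => exs.
  set b := foldr _ _ _; set b' := foldr _ _ _; suff <- : b = b' by exact: exs.
  rewrite {}/b {}/b'.
  have eeq k (a b : term (ba_ext X) k) :
      code_formula cB (feq a b) = s_eq (code_term cB a) (code_term cB b) by [].
  (* In the base case the variable under [Fin] is [m + 0] in the formula and [m] in the program. *)
  elim: (enum 'I_(size s)) => [|i r IH]; first by rewrite /= addn0.
  by cbn [foldr comp]; rewrite IH eeq code_bmeet code_tren.
- have -> : [seq code_formula cL (fex (tnth (in_tuple s) j).2) | j <- enum 'I_(size s)] =
      [seq code_formula cL (fex p.2) | p <- s].
    by rewrite -[RHS](congr1 _ (map_tnth_enum (in_tuple s))) -map_comp.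
  exact: run_ex_all.
Qed.

(** The names given by [cL] and [cX] are copied and never inspected, so one program serves all
    codings. *)
Lemma run_to_form (Phi : formula L 1) n (theta : formula (fv_lang L X) n) :
  run f_form (Cons (code_formula cL Phi) (code_formula cF theta))
    (code_form (to_form Phi theta)).
Proof.
elim: theta => {n} [n t u|n [R|s] a|n a IH|n a IHa b IHb|n a IH].
- by rewrite code_everywhere /= !code_term_fv; eval_body.
- rewrite code_everywhere /=; under [in X in evals _ _ _ X]eq_map do rewrite code_term_fv.
  by eval_body.
- eval_body; under eq_map do rewrite -code_term_fv.
  exact: run_substs.
- by eval_body; [exact: IH|eval_body].
- by eval_body; [exact: IHa|exact: IHb|exact: run_form_and].
- by eval_body; [exact: IH|exact: run_form_ex].
Qed.

Lemma computes_form_formula (Phi : formula L 1) n (theta : formula (fv_lang L X) n) :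
  computes qe_program
    (slist [:: code_formula cL Phi; Atom n; code_formula cF theta])
    (code_formula cF (form_formula (to_form Phi theta))).
Proof.
rewrite /computes; eval_body; first exact: run_to_form.
eval_body.
have -> : [seq code_term cF (tvar k) | k <- enum 'I_n] =
    [seq s_tvar (Atom i) | i <- iota 0 n] ++ [::].
  by rewrite cats0 -map_nat_enum_ord -map_comp.
exact: (run_vars _ _ [::]).
Qed.

End FormulaCodes.

Theorem theorem2 (L X : language) :
  exists p : program,
  forall (cL : coding L) (cX : coding X)
         (Phi : formula L 1) (n : nat) (theta : formula (fv_lang L X) n),
  exists theta' : formula (fv_lang L X) n,
    quantifier_free theta' /\
    computes p
      (slist [:: code_formula cL Phi; Atom n; code_formula (fv_coding cL cX) theta])
      (code_formula (fv_coding cL cX) theta') /\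
    forall (I : Type) (B : interp (ba_ext X) (set I)) (hB : powerset_structure B)
           (M : I -> Type) (A : forall i : I, interp L (M i))
           (hPhi : forall i : I, substructure (A i) (definable (A i) Phi))
           (v : 'I_n -> {f : forall i : I, M i | restricted A Phi f}),
      sat (restricted_interp B hPhi) theta v <->
      sat (restricted_interp B hPhi) theta' v.
Proof.
exists qe_program => cL cX Phi n theta; exists (form_formula (to_form Phi theta)).
split=> //; split; first exact: computes_form_formula.
(* Satisfaction of the atom [form_formula] is [form_sat] by definition, so only the side of [theta]
   needs rewriting. *)
by move=> I B hB M A hPhi v; rewrite (sat_to_form hB).
Qed.
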